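(* Let $n\ge 2$, let $f$ be a parking configuration on the complete graph $K_n$, let $w=\phi(f)$ and let $\eta_1,\eta_2,\ldots,\eta_{n-1}$ be the sequence of heights of $w$. Let $q$ and $r$ be the quotient and the remainder of the Euclidean division of $f_n+1$ by $n-1$ (so $f_n+1=q(n-1)+r$ with $0\le r<n-1$). Then the rank $\rho(f)$ of $f$ satisfies $$1+\rho(f)=\sum_{i=1}^{n-1}\max\bigl(0,\;q-\eta_i+\chi(i\le r)\bigr),$$ where $\chi(i\le r)=1$ if $i\le r$ and $\chi(i\le r)=0$ otherwise.
   Context: A configuration on $K_n$ (vertices $x_1,\ldots,x_n$) is an element $f=(f_1,\ldots,f_n)\in\mathbb{Z}^n$ and $\deg(f)=\sum_{i=1}^n f_i$. Let $\varepsilon^{(i)}$ be the $i$-th standard basis vector, $\Delta^{(i)}=(n-1)\varepsilon^{(i)}-\sum_{j\ne i}\varepsilon^{(j)}$, and let $L_G$ be the subgroup of $\mathbb{Z}^n$ generated by the $\Delta^{(i)}$. Two configurations $f,g$ are toppling equivalent if $f-g\in L_G$. A configuration is effective if all its entries are $\ge 0$, and $L_G$-effective if it is toppling equivalent to an effective configuration. Rank: $\rho(f)=-1$ if $f$ is not $L_G$-effective; otherwise $\rho(f)$ is the largest integer $r$ such that $f-\lambda$ is $L_G$-effective for every effective configuration $\lambda$ of degree $r$. A configuration $f$ on $K_n$ is a parking configuration if $f_i\ge 0$ for all $i<n$ and for every non-empty $Y\subseteq\{1,\ldots,n-1\}$ there is $k\in Y$ with $f_k<n-|Y|$ (no condition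 on $f_n$). Words are over the alphabet $\{a,b\}$; $|u|_a,|u|_b$ are the numbers of occurrences of $a$ and $b$ in $u$, and $\delta(u)=|u|_a-|u|_b$. $D_n$ is the set of words $w$ with $n-1$ letters $a$ and $n$ letters $b$ such that $\delta(u)\ge 0$ for every strict prefix $u$ of $w$. For a parking configuration $f$, let $g_1\le\cdots\le g_{n-1}$ be the weakly increasing rearrangement of $f_1,\ldots,f_{n-1}$; $\phi(f)\in D_n$ is the word with $n-1$ letters $a$ and $n$ letters $b$ in which the prefix ending with the $i$-th occurrence of $a$ contains exactly $g_i$ occurrences of $b$. The sequence of heights of a word $w$ is $\eta_1,\eta_2,\ldots$, where $\eta_i=\delta(w^{(i)})$ and $w^{(i)}$ is the prefix of $w$ immediately preceding the $i$-th occurrence of $a$. *)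

(* Defs.v *)
From mathcomp Require Import all_boot all_order all_algebra.
From mathcomp Require Import boolp classical_sets.
From mathcomp Require Import zify.

Set Implicit Arguments.
Unset Strict Implicit.
Unset Printing Implicit Defensive.

Import Order.TTheory GRing.Theory Num.Theory.
Local Open Scope ring_scope.

(* The vertex x_i of K_n, 1 <= i <= n, is the ordinal i.-1 : 'I_n; the vertices
   x_1, ..., x_(n-1) are the ordinals smaller than n.-1. *)
Definition config (n : nat) := {ffun 'I_n -> int}.

Definition last_vertex (n : nat) (n_ge2 : (2 <= n)%N) : 'I_n :=
  Ordinal (etrans (ltn_predL n) (ltnW n_ge2)).

Section Configurations.
Variable n : nat.
Implicit Types f g l : config n.

Definition deg f : int := \sum_i f i.

Definition basis_vector (i : 'I_n) : config n := [ffun j => (j == i)%:R].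

Definition Delta (i : 'I_n) : config n :=
  basis_vector i *~ (n%:Z - 1) - \sum_(j | j != i) basis_vector j.

Definition toppling_equiv f g : Prop :=
  inIntSpan [tuple Delta i | i < n] (f - g).

Definition effective f : Prop := forall i, 0 <= f i.

Definition L_effective f : Prop := exists2 g, effective g & toppling_equiv f g.

Definition all_removable f (r : int) : Prop :=
  forall l, effective l -> deg l = r -> L_effective (f - l).

Definition largest (P : int -> Prop) (r : int) : Prop :=
  P r /\ forall s, P s -> s <= r.

(* When n > 0 and f is L_G-effective the largest such integer exists
   (lemma [rankP]), so the default value of [xget] is then irrelevant. *)
Definition rank f : int :=
  if `[< L_effective f >] then xget (-1) [set r | largest (all_removable f) r]
  else -1.

Definition parking f : Prop :=
  (forall i : 'I_n, (i < n.-1)%N -> 0 <= f i) /\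
  (forall Y : {set 'I_n}, Y != finset.set0 ->
     (forall k, k \in Y -> (k < n.-1)%N) ->
     exists2 k, k \in Y & f k < n%:Z - #|Y|%:Z).

(* The weakly increasing rearrangement of f_1, ..., f_(n-1), as a list indexed
   from 0. *)
Definition rearrangement f : seq int :=
  sort <=%R [seq f i | i : 'I_n <- enum 'I_n & (i < n.-1)%N].

End Configurations.

(* The letter a is [true] and the letter b is [false]. *)
Definition word := seq bool.
Definition letter_a : bool := true.
Definition letter_b : bool := false.

Definition nb_a (u : word) : nat := count_mem letter_a u.
Definition nb_b (u : word) : nat := count_mem letter_b u.

Definition delta (u : word) : int := (nb_a u)%:Z - (nb_b u)%:Z.

Definition D (n : nat) (w : word) : Prop :=
  [/\ nb_a w = n.-1, nb_b w = n
    & forall u, prefix u w -> u != w -> 0 <= delta u].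

Definition positions (w : word) : seq nat :=
  [seq k <- iota 0 (size w) | nth letter_b w k == letter_a].

(* Occurrences of a are numbered from 1, positions in a word from 0. *)
Definition pos_a (w : word) (i : nat) : nat := nth (size w) (positions w) i.-1.

Definition prefix_before (w : word) (i : nat) : word := take (pos_a w i) w.
Definition prefix_upto (w : word) (i : nat) : word := take (pos_a w i).+1 w.

Definition height (w : word) (i : nat) : int := delta (prefix_before w i).

Definition is_phi (n : nat) (f : config n) (w : word) : Prop :=
  D n w /\
  forall i : nat, (1 <= i <= n.-1)%N ->
    (nb_b (prefix_upto w i))%:Z = (rearrangement f)`_i.-1.

(* For a parking configuration there is exactly one such word (lemmas [phiP]
   and [is_phi_uniq]), so the default value of [xget] is then irrelevant. *)
Definition phi (n : nat) (f : config n) : word := xget [::] [set w | is_phi f w].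

Section RankWellDefined.
Variable n : nat.
Implicit Types f g l : config n.

Lemma degB f g : deg (f - g) = deg f - deg g.
Proof. by rewrite /deg -sumrB; apply: eq_bigr => i _; rewrite !ffunE. Qed.

Lemma deg_basis_vector i : deg (basis_vector i : config n) = 1.
Proof.
rewrite /deg (bigD1 i) //= ffunE eqxx big1 ?addr0 // => j /negbTE ji.
by rewrite ffunE ji.
Qed.

Lemma degMz f (k : int) : deg (f *~ k) = deg f *~ k.
Proof.
have degN : {morph @deg n : x y / x - y} by move=> x y; rewrite degB.
have deg0 : deg (0 : config n) = 0 by rewrite /deg big1 // => i _; rewrite ffunE.
have degMn m : deg (f *+ m) = deg f *+ m.
  elim: m => [|m IH]; rewrite ?mulr0n ?deg0 // !mulrS -IH.
  by rewrite -[X in f + X]opprK degB -[- (f *+ m)]sub0r degB deg0 sub0r opprK.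
case: k => m; first by rewrite -!pmulrn degMn.
by rewrite NegzE !mulrNz -!pmulrn -[- _]sub0r degB deg0 degMn sub0r.
Qed.

Lemma deg_sum (I : Type) (s : seq I) (P : pred I) (F : I -> config n) :
  deg (\sum_(i <- s | P i) F i) = \sum_(i <- s | P i) deg (F i).
Proof.
rewrite /deg exchange_big /=; apply: eq_bigr => j _.
by rewrite sum_ffunE.
Qed.

Lemma deg_Delta i : deg (Delta i : config n) = 0.
Proof.
rewrite /Delta degB degMz deg_sum deg_basis_vector.
rewrite (eq_bigr (fun=> 1)) => [|j _]; last exact: deg_basis_vector.
rewrite sumr_const (@eq_card _ _ (predC1 i)) // cardC1 card_ord.
by have := ltn_ord i; rewrite -mulrzr; lia.
Qed.

Lemma toppling_equiv_deg f g : toppling_equiv f g -> deg f = deg g.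
Proof.
case=> c /(congr1 (@deg n)); rewrite degB deg_sum big1 => [/eqP|i _].
  by rewrite subr_eq0 => /eqP.
by rewrite degMz -tnth_nth tnth_mktuple deg_Delta mul0rz.
Qed.

Lemma L_effective_deg f : L_effective f -> 0 <= deg f.
Proof.
by case=> g g_ge0 /toppling_equiv_deg->; apply: sumr_ge0 => i _; apply: g_ge0.
Qed.

Lemma largest_exists f : (0 < n)%N -> L_effective f ->
  exists r, largest (all_removable f) r.
Proof.
move=> n_gt0 Lf; pose P m := `[< all_removable f m%:Z >].
have bound (s : int) : all_removable f s -> s <= deg f.
  move=> rs; have [s_lt0|s_ge0] := ltP s 0.
    exact: le_trans (ltW s_lt0) (L_effective_deg Lf).
  pose l : config n := basis_vector (Ordinal n_gt0) *~ s.
  have dl : deg l = s by rewrite degMz deg_basis_vector intz.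
  have l_ge0 : effective l.
    rewrite /l; case: s s_ge0 {rs l dl} => // m _ i.
    by rewrite -pmulrn ffunMnE mulrn_wge0 // ffunE ler0n.
  by have /L_effective_deg := rs l l_ge0 dl; rewrite degB dl subr_ge0.
have P0 : exists m, P m.
  exists 0%N; apply/asboolP => l l_ge0 dl; have {}dl : deg l = 0 by [].
  suff -> : l = 0 by rewrite subr0.
  apply/ffunP => i; rewrite ffunE; apply: le_anti.
  rewrite l_ge0 andbT -dl /deg (bigD1 i) //= lerDl.
  by apply: sumr_ge0 => j _; apply: l_ge0.
have Pb m : P m -> (m <= `|deg f|)%N.
  by move=> /asboolP /bound; have := L_effective_deg Lf; lia.
case: (ex_maxnP P0 Pb) => m /asboolP Pm maxm; exists m%:Z; split=> // s rs.
have [|s_ge0] := ltP s 0; first by lia.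
have /maxm : P `|s|%N by apply/asboolP; rewrite gez0_abs.
by lia.
Qed.

Lemma rankP f : (0 < n)%N ->
  (L_effective f -> largest (all_removable f) (rank f)) /\
  (~ L_effective f -> rank f = -1).
Proof.
move=> n_gt0; rewrite /rank; case: asboolP => Lf; split=> // _.
by have := xgetPex (-1) (largest_exists n_gt0 Lf).
Qed.

Lemma largest_uniq (P : int -> Prop) r s : largest P r -> largest P s -> r = s.
Proof. by move=> [Pr mr] [Ps ms]; apply/le_anti; rewrite ms ?mr. Qed.

End RankWellDefined.

Section PhiWellDefined.
Local Open Scope nat_scope.

Lemma nb_ab (u : word) : nb_a u + nb_b u = size u.
Proof.
rewrite -(count_predC (pred1 letter_a) u) /nb_a /nb_b; congr (_ + _).
by apply: eq_count; case.
Qed.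

Lemma positions_cons x (w : word) :
  positions (x :: w) = nseq x 0 ++ [seq k.+1 | k <- positions w].
Proof.
rewrite /positions /= (iotaDl 1 0) filter_map.
by case: x.
Qed.

Lemma size_positions w : size (positions w) = nb_a w.
Proof.
elim: w => // x w IH; rewrite positions_cons size_cat size_nseq size_map IH.
by case: x.
Qed.

Lemma pos_aP w i : i < nb_a w ->
  [/\ pos_a w i.+1 < size w, nb_a (prefix_before w i.+1) = i
    & nb_a (prefix_upto w i.+1) = i.+1].
Proof.
rewrite /prefix_before /prefix_upto /pos_a /=.
elim: w i => // x w IH i; rewrite positions_cons.
case: x => /=; last first.
  rewrite /nb_a /= add0n => lt_i; have [] := IH i lt_i.
  by rewrite (nth_map (size w)) ?size_positions //=; split; rewrite /nb_a /= ?add0n.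
case: i => [|i] //=; first by rewrite take0.
rewrite /nb_a /= add1n ltnS => lt_i; have [] := IH i lt_i.
rewrite (nth_map (size w)) ?size_positions //= => H1 H2 H3.
by split; rewrite // /nb_a /= add1n; congr _.+1.
Qed.

Lemma size_prefix_upto w i : i < nb_a w ->
  (pos_a w i.+1).+1 = i.+1 + nb_b (prefix_upto w i.+1).
Proof.
move=> lt_i; have [lt_p _ H] := pos_aP lt_i.
by rewrite -{2}H nb_ab /prefix_upto size_takel.
Qed.

Lemma word_positions w : w = [seq k \in positions w | k <- iota 0 (size w)].
Proof.
apply: (@eq_from_nth _ letter_b); first by rewrite size_map size_iota.
move=> i lt_i; rewrite (nth_map 0) ?size_iota // nth_iota // add0n.
by rewrite mem_filter mem_iota lt_i andbT; case: nth.
Qed.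

Lemma nb_a_take w k l : k <= l -> nb_a (take k w) <= nb_a (take l w).
Proof.
move=> le_kl; rewrite -(take_takel w le_kl); apply: leq_count_subseq.
exact: take_subseq.
Qed.

Variables (n : nat) (f : config n).

Lemma size_rearrangement : size (rearrangement f) = n.-1.
Proof.
rewrite size_sort size_map -(size_map val) -(filter_map val (fun k => k < n.-1)) val_enum_ord.
rewrite -[RHS](size_iota 0); congr size.
apply: (irr_sorted_eq ltn_trans ltnn).
- by apply: sorted_filter; [exact: ltn_trans | exact: iota_ltn_sorted].
- exact: iota_ltn_sorted.
by move=> k; rewrite mem_filter !mem_iota; lia.
Qed.

Lemma is_phi_uniq w w' : is_phi f w -> is_phi f w' -> w = w'.
Proof.
move=> [[aw bw _] Hw] [[aw' bw' _] Hw'].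
have sz : size w = size w' by rewrite -!nb_ab aw aw' bw bw'.
suff pos : positions w = positions w'.
  by rewrite (word_positions w) (word_positions w') pos sz.
apply: (@eq_from_nth _ (size w)) => [|i]; rewrite !size_positions; first by rewrite aw.
move=> lt_i; have lt_i' : i < nb_a w' by rewrite aw' -aw.
have := size_prefix_upto lt_i; have := size_prefix_upto lt_i'.
have := Hw i.+1; have := Hw' i.+1; rewrite -aw lt_i => /(_ isT) <- /(_ isT) [->] <- [].
by rewrite /pos_a -sz.
Qed.

Hypothesis f_parking : parking f.

Lemma rearrangement_ge0 i : (0 <= (rearrangement f)`_i)%R.
Proof.
have [lt_i|le_i] := ltnP i (size (rearrangement f)); last by rewrite nth_default.
have := mem_nth 0%R lt_i; rewrite mem_sort => /mapP[k].
by rewrite mem_filter => /andP[lt_k _] ->; apply: f_parking.1.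
Qed.

Lemma rearrangement_mono i j : i <= j -> j < n.-1 ->
  ((rearrangement f)`_i <= (rearrangement f)`_j)%R.
Proof.
move=> le_ij lt_j.
apply: (sorted_leq_nth le_trans le_refl) => //.
- exact: (sort_sorted le_total).
- by rewrite inE size_rearrangement; apply: leq_ltn_trans lt_j.
- by rewrite inE size_rearrangement.
Qed.

Lemma rearrangement_le i : i < n.-1 -> ((rearrangement f)`_i <= i%:Z)%R.
Proof.
move=> lt_i; case: leP => // gt_i.
pose p (z : int) := (i%:Z < z)%R.
pose Y := [set k : 'I_n | (k < n.-1) && p (f k)].
have memY k : (k \in Y) = (k < n.-1) && p (f k) by rewrite finset.in_set.
have cardY : #|Y| = count p (rearrangement f).
  have /permP -> := permEl (perm_sort <=%R [seq f i | i : 'I_n <- enum 'I_n & i < n.-1]).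
  rewrite count_map count_filter cardE -size_filter; congr size.
  rewrite enumT; apply: eq_filter => k; rewrite -[LHS]/(k \in Y) memY /=.
  by rewrite andbC.
have leY : n.-1 - i <= #|Y|.
  rewrite cardY -(cat_take_drop i (rearrangement f)) count_cat.
  suff : all p (drop i (rearrangement f)).
    by rewrite all_count => /eqP->; rewrite size_drop size_rearrangement leq_addl.
  apply/(all_nthP 0%R) => j; rewrite size_drop size_rearrangement => lt_j.
  rewrite nth_drop; apply: lt_le_trans gt_i _; apply: rearrangement_mono; lia.
have [|k|k] := f_parking.2 Y.
- by rewrite -card_gt0; apply: leq_trans leY; rewrite subn_gt0.
- by rewrite memY => /andP[].
rewrite memY /p => /andP[_]; move: (f k) => z.
by move: leY; move: #|Y| => c; lia.
Qed.

Lemma is_phi_exists : exists w, is_phi f w.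
Proof.
pose g (i : nat) : nat := absz ((rearrangement f)`_i)%R.
have gE i : (g i)%:Z = ((rearrangement f)`_i)%R.
  by rewrite gez0_abs // rearrangement_ge0.
clearbody g.
have g_le i : i < n.-1 -> g i <= i.
  by move=> /rearrangement_le; rewrite -gE; lia.
have g_mono i j : i <= j -> j < n.-1 -> g i <= g j.
  by move=> le_ij lt_j; have := rearrangement_mono le_ij lt_j; rewrite -!gE; lia.
pose Ps := [seq i + g i | i <- iota 0 n.-1].
pose w : word := [seq k \in Ps | k <- iota 0 (n.-1 + n)].
have sw : size w = n.-1 + n by rewrite size_map size_iota.
have posw : positions w = Ps.
  apply: (irr_sorted_eq ltn_trans ltnn).
  - by apply: sorted_filter; [exact: ltn_trans | exact: iota_ltn_sorted].
  - apply/(sortedP 0) => i; rewrite size_map size_iota => lt_i.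
    rewrite !(nth_map 0) ?size_iota ?nth_iota //; try lia.
    by rewrite !add0n addSn ltnS leq_add2l g_mono.
  move=> k; rewrite mem_filter sw mem_iota add0n /=.
  case: (ltnP k (n.-1 + n)) => [lt_k|le_k].
    by rewrite (nth_map 0) ?size_iota // nth_iota // andbT; case: (_ \in _).
  rewrite andbF; apply/esym/negbTE/mapP => -[i]; rewrite mem_iota => lt_i kE.
  by have := g_le i lt_i; lia.
have aw : nb_a w = n.-1 by rewrite -size_positions posw size_map size_iota.
have bw : nb_b w = n by have := nb_ab w; rewrite aw sw; lia.
have pw i : i < n.-1 -> pos_a w i.+1 = i + g i.
  move=> lt_i; rewrite /pos_a posw /= (nth_map 0) ?size_iota // nth_iota //.
have uw i : i < n.-1 -> nb_b (prefix_upto w i.+1) = g i.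
  by move=> lt_i; have := @size_prefix_upto w i; rewrite aw pw //; lia.
exists w; split; last first.
  by case=> // i /= lt_i; rewrite uw // gE.
split=> // u pre_u ne_u.
have {pre_u} uE : u = take (size u) w by move/prefixP: pre_u => [v ->]; rewrite take_size_cat.
have lt_u : size u < size w.
  by rewrite ltnNge; apply: contra ne_u => /take_oversize; rewrite -uE => ->.
have := nb_ab u; rewrite /delta subr_ge0 lez_nat; set j := nb_a u => szu.
have le_j : j <= n.-1 by rewrite /j uE -aw -{2}(take_size w) nb_a_take // ltnW.
rewrite sw -szu in lt_u.
have [lt_j|ge_j] := ltnP j n.-1; last first.
  by move: {szu} lt_u le_j ge_j; move: (j) (nb_b u) => x y; lia.
have le_gj := g_le j lt_j; have [le_P|lt_P] := leqP (size u) (j + g j).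
  by move: le_P; rewrite -szu leq_add2l => /leq_trans; apply.
have := @nb_a_take w (j + g j).+1 (size u) lt_P; rewrite -uE -/j.
have [|_ _] := @pos_aP w j; first by rewrite aw.
by rewrite /prefix_upto pw // => ->; rewrite ltnn.
Qed.

Lemma phiP : is_phi f (phi f).
Proof. exact: (xgetPex [::] is_phi_exists). Qed.

End PhiWellDefined.

(* Main.v *)
Require Import Defs.
From mathcomp Require Import all_boot all_order all_fingroup all_algebra.
From mathcomp Require Import zify ring.
Import Order.TTheory GRing.Theory Num.Theory.
Local Open Scope ring_scope.

(** The maximal configurations that are not [L_effective] are exactly the u with
    pairwise distinct residues mod n and degree (0 + 1 + ... + (n-1)) - n, so
    1 + rank f is the minimum over such u of sum_i max(0, f_i - u_i).  Put m = n - 1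
    and D = u_n + 1; the first m entries of u have sum (0 + ... + (m-1)) - D.
    If two of them differ by more than n, moving both by n towards each other does
    not increase the cost.  So they may be assumed to lie in a window of length n,
    and then in increasing order they are i - q' - [i < r'], where
    D = q' m + r'.  The resulting cost is 1-Lipschitz in D, hence the best choice
    of u_n is f_n, which gives D = f_n + 1 = q m + r.  Heights being i - g_i, this
    is the claimed sum. *)

(** * Maximal configurations that are not [L_effective] *)

Definition distinct_residues {I : Type} (d : nat) (u : I -> int) : Prop :=
  injective (fun i => (u i %% d)%Z).

(** An injection into the n residues modulo n is a bijection, so the sum can be reindexed. *)
Lemma sum_distinct_residues (n : nat) (u : 'I_n -> int) :
  distinct_residues n u -> \sum_i (u i %% n)%Z = \sum_(i < n) i%:Z.
Proof.
case: n u => [|n] u u_inj; first by rewrite !big_ord0.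
have bd i : 0 <= (u i %% n.+1)%Z < n.+1%:Z by rewrite modz_ge0 ?ltz_pmod.
pose v i : 'I_n.+1 := inord `|(u i %% n.+1)%Z|%N.
have vE i : (v i)%:Z = (u i %% n.+1)%Z.
  by rewrite /v inordK; have := bd i; lia.
have v_inj : injective v.
  by move=> i j /(congr1 (fun k : 'I__ => k%:Z)); rewrite !vE => /u_inj.
by rewrite [RHS](reindex_inj v_inj) /=; apply: eq_bigr => i _; rewrite vE.
Qed.

(** [Delta i] is n times the i-th basis vector minus the all-ones vector. *)
Lemma Delta_comb (n : nat) (c : 'I_n -> int) (k : 'I_n) :
  (\sum_(i < n) [tuple Delta i | i < n]`_i *~ c i) k = n%:Z * c k - \sum_(i < n) c i.
Proof.
have sum_pred1 : \sum_(i < n) c i * (k == i)%:R = c k.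
  rewrite (bigD1 k) //= eqxx mulr1 big1 ?addr0 // => i.
  by rewrite eq_sym => /negbTE->; rewrite mulr0.
have DeltaE (i : 'I_n) : Delta i k = n%:Z * (k == i)%:R - 1.
  have -> : Delta i = basis_vector i *~ n%:Z - \sum_j basis_vector j.
    by rewrite /Delta [X in _ = _ - X](bigD1 i) //= mulrzBr mulr1z opprD addrA.
  rewrite !ffunE sum_ffunE ffunMzE ffunE (bigD1 k) //= ffunE eqxx big1.
    by rewrite addr0 -mulrzr intz mulrC.
  by move=> j /negbTE kj; rewrite ffunE eq_sym kj.
rewrite sum_ffunE -[c k]sum_pred1 mulr_sumr -sumrB.
apply: eq_bigr => i _; rewrite -tnth_nth tnth_mktuple ffunMzE DeltaE -mulrzr intz.
by ring.
Qed.

Lemma L_effectiveP (n : nat) (f : config n) :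
  L_effective f <->
  exists (c : 'I_n -> int) (s : int), s = \sum_(i < n) c i /\
    forall k : 'I_n, 0 <= f k - n%:Z * c k + s.
Proof.
split=> [[g g_ge0 [c fg]]|[c [s [sE fc]]]].
  exists c, (\sum_(i < n) c i); split=> // k.
  suff -> : f k - n%:Z * c k + \sum_(i < n) c i = g k by [].
  have := congr1 (fun h : config n => h k) fg; rewrite /= Delta_comb !ffunE.
  by set s := \sum_(i < n) _; move: s (c k) (f k) (g k) => s ck fk gk; lia.
exists [ffun k => f k - n%:Z * c k + s] => [k|]; first by rewrite ffunE.
exists (finfun c); apply/ffunP => k.
have cE i : finfun c i = c i by rewrite ffunE.
rewrite Delta_comb !ffunE [in RHS](eq_bigr c) => [|i _]; last exact: cE.
by rewrite -sE; move: (c k) (f k) => ck fk; lia.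
Qed.

Lemma L_effective_le (n : nat) (f g : config n) :
  (forall i, f i <= g i) -> L_effective f -> L_effective g.
Proof.
move=> fg /L_effectiveP[c [s [sE fc]]]; apply/L_effectiveP; exists c, s.
by split=> // k; have := fc k; have := fg k; lia.
Qed.

(** Configurations equivalent to [u] have entries congruent to u_k + s, again with distinct
    residues. If all were nonnegative, their sum would be at least 0 + ... + (n-1), more than the
    degree of [u]. *)
Lemma not_L_effective_distinct (n : nat) (u : config n) :
  (0 < n)%N -> distinct_residues n u -> \sum_i u i = \sum_(i < n) i%:Z - n%:Z ->
  ~ L_effective u.
Proof.
move=> n_gt0 u_inj deg_u /L_effectiveP[c [s [sE uc]]].
pose e k := u k - n%:Z * c k + s.
have e_inj : distinct_residues n e.
  move=> i j /eqP; rewrite eqz_mod_dvd => ij; apply: u_inj => /=.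
  apply/eqP; rewrite eqz_mod_dvd.
  suff -> : u i - u j = e i - e j + (c i - c j) * n%:Z.
    by rewrite rpredD ?dvdz_mull.
  by rewrite /e; ring.
have : \sum_i (e i %% n)%Z <= \sum_i e i.
  apply: ler_sum => i _; rewrite {2}(divz_eq (e i) n) lerDr mulr_ge0 //.
  by rewrite divz_ge0 ?uc.
rewrite (sum_distinct_residues n e e_inj) /e big_split sumrB /= deg_u.
rewrite sumr_const card_ord -mulr_sumr -mulr_natl -sE.
by move: (\sum_(i < n) i%:Z) => S; lia.
Qed.

(** Toppling reduces every vertex but [z] modulo n, and [z] compensates so that the toppling counts
    add up to 0. The crude bound serves to end the recursion in [not_L_effective_le_distinct]. *)
Lemma L_effective_deg_ge (n : nat) (h : config n) :
  (0 < n)%N -> n%:Z * n%:Z <= deg h -> L_effective h.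
Proof.
move=> n_gt0 deg_h; apply/L_effectiveP.
pose z := Ordinal n_gt0.
pose d k := (h k %/ n)%Z.
pose c k := if k == z then - \sum_(i | i != z) d i else d k.
have c0 : \sum_(i < n) c i = 0.
  rewrite (bigD1 z) //= {1}/c eqxx; apply/eqP; rewrite addrC subr_eq0; apply/eqP.
  by apply: eq_bigr => i /negbTE iz; rewrite /c iz.
have n0 : n%:Z != 0 by lia.
have dE k : h k = d k * n%:Z + (h k %% n)%Z by exact: divz_eq.
have bd k : 0 <= (h k %% n)%Z < n%:Z by rewrite modz_ge0 // ltz_pmod.
exists c, 0; split=> // k; rewrite addr0 /c; case: eqP => [->|_]; last first.
  by have := bd k; have := dE k; lia.
have : deg h = h z + n%:Z * (\sum_(i | i != z) d i) + \sum_(i | i != z) (h i %% n)%Z.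
  rewrite /deg (bigD1 z) //= -addrA mulr_sumr -big_split /=; congr (_ + _).
  by apply: eq_bigr => i _; rewrite {1}dE mulrC.
have : \sum_(i | i != z) (h i %% n)%Z <= n%:Z * n%:Z.
  apply: le_trans (_ : \sum_(i < n) n%:Z <= _); last first.
    by rewrite sumr_const card_ord -mulr_natl natz.
  rewrite [leRHS](bigD1 z) //=; apply: ler_wpDl => //.
  by apply: ler_sum => i _; have := bd i; lia.
by lia.
Qed.

Lemma maximal_distinct (n : nat) (h : config n) : (0 < n)%N ->
  ~ L_effective h -> (forall i, L_effective (h + basis_vector i)) ->
  distinct_residues n h /\ \sum_i h i = \sum_(i < n) i%:Z - n%:Z.
Proof.
move=> n_gt0 nLh Lh.
(* A configuration equivalent to h is -1 at i and at most n - 2 elsewhere: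
   otherwise one more toppling would make it effective. *)
have normal i : exists (c : 'I_n -> int) (s : int), [/\ s = \sum_(k < n) c k,
    h i - n%:Z * c i + s = -1 &
    forall j, j != i -> 0 <= h j - n%:Z * c j + s <= n%:Z - 2].
  have /L_effectiveP[c [s [sE hc]]] := Lh i; exists c, s; split=> // [|j ji].
    have hi := hc i; rewrite !ffunE eqxx in hi.
    have [lt0|ge0] := ltP (h i - n%:Z * c i + s) 0;
      first by move: (h i) (c i) hi lt0 => hi ci; lia.
    case: nLh; apply/L_effectiveP; exists c, s; split=> // k.
    have := hc k; rewrite !ffunE; case: eqP => [->|_] /=; first by [].
    by rewrite addr0.
  have hj := hc j; rewrite !ffunE (negbTE ji) addr0 in hj.
  rewrite hj /=; case: leP => // gtj; case: nLh; apply/L_effectiveP.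
  exists (fun k => c k + (k == j)%:R), (s + 1); split=> [|k].
    by rewrite big_split /= -sE (bigD1 j) //= eqxx big1 ?addr0 // => l /negbTE->.
  have hk := hc k; rewrite !ffunE in hk; move: hk.
  case: (eqVneq k j) => [->|_]; first by rewrite (negbTE ji); lia.
  by case: (k == i); move: (h k) (c k) => hk ck /=; lia.
have h_inj : distinct_residues n h.
  move=> j i /= /eqP; rewrite eqz_mod_dvd => dv; apply/eqP/negPn/negP => ji.
  (* Equal residues would make the entry at j congruent to -1 modulo n, impossible between 0 and n -
     2. *)
  have [c [s [_ ci /(_ j ji) cj]]] := normal i.
  have : (n %| h j - n%:Z * c j + s + 1)%Z.
    suff -> : h j - n%:Z * c j + s + 1 = h j - h i + (c i - c j) * n%:Z.
      by rewrite rpredD ?dvdz_mull.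
    by rewrite -[1]opprK -ci; ring.
  case/dvdzP => k kE; have : 0 < k * n%:Z < n%:Z by lia.
  by rewrite pmulr_lgt0 ?gtr_pMl //; lia.
split=> //; have [c [s [sE ci cj]]] := normal (Ordinal n_gt0).
(* Raised by 1, all entries lie between 0 and n - 1, so each is its own residue. *)
pose e k := h k - n%:Z * c k + s + 1.
have e_inj : distinct_residues n e.
  move=> i j /eqP; rewrite eqz_mod_dvd => ij; apply: h_inj => /=.
  apply/eqP; rewrite eqz_mod_dvd.
  suff -> : h i - h j = e i - e j + (c i - c j) * n%:Z.
    by rewrite rpredD ?dvdz_mull.
  by rewrite /e; ring.
rewrite -(sum_distinct_residues n e e_inj).
rewrite [in RHS](eq_bigr e) => [|k _]; last first.
  rewrite modz_small // /e; case: (eqVneq k (Ordinal n_gt0)) => [->|/cj]; last by lia.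
  by rewrite ci; lia.
rewrite (eq_bigr (fun k => h k - (n%:Z * c k - (s + 1)))) => [|k _]; last by rewrite /e; ring.
rewrite !sumrB sumr_const card_ord -mulr_sumr -mulr_natl -sE.
by move: (\sum_(i < n) h i) => S; lia.
Qed.

(** Basis vectors are added while the result is not [L_effective]; this stops because a large degree
    forces effectivity. *)
Lemma not_L_effective_le_distinct (n : nat) (h : config n) : (0 < n)%N ->
  ~ L_effective h ->
  exists u : config n, [/\ forall i, h i <= u i, distinct_residues n u &
    \sum_i u i = \sum_(i < n) i%:Z - n%:Z].
Proof.
move=> n_gt0; have [k] : exists k : nat, (n%:Z * n%:Z <= deg h + k%:Z)%R.
  by exists `|(n%:Z * n%:Z - deg h)%R|%N; lia.
elim: k h => [|k IH] h.
  by rewrite addr0 => /(L_effective_deg_ge n h n_gt0).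
move=> deg_h nLh; have [Lh|/boolp.existsNP[i nLi]] :=
  boolp.pselect (forall i, L_effective (h + basis_vector i)).
  by have [h_inj deg_h'] := maximal_distinct n h n_gt0 nLh Lh; exists h.
have [|u [hu u_inj deg_u]] := IH (h + basis_vector i) _ nLi.
  have -> : deg (h + basis_vector i) = deg h + 1.
    rewrite -(deg_basis_vector i) /deg -big_split /=.
    by apply: eq_bigr => j _; rewrite !ffunE.
  by lia.
exists u; split=> // j; apply: le_trans (hu j).
by rewrite !ffunE lerDl ler0n.
Qed.

(** * The clipped sum as a function of q m + r *)

(* Besides 0 <= r < m the value r = m is allowed; it gives the same sum as (q + 1, 0). *)
Definition clip_sum (m : nat) (g : 'I_m -> int) (q r : int) : int :=
  \sum_(i < m) Num.max 0 (g i - i%:Z + q + (i%:Z < r)%R%:Z).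

Lemma sum_lt (m : nat) (r : int) : 0 <= r <= m%:Z ->
  \sum_(i < m) (i%:Z < r)%R%:Z = r.
Proof.
elim: m r => [|m IH] r r_le; first by rewrite big_ord0; lia.
rewrite big_ord_recr /=; have [rm|rm] := leP r m%:Z.
  by rewrite IH; lia.
have -> : r = m.+1%:Z by lia.
rewrite (eq_bigr (fun i : 'I_m => (i%:Z < m%:Z)%R%:Z)) => [|i _]; last first.
  by have := ltn_ord i; lia.
by rewrite IH; lia.
Qed.

(** The numbers q + [i < r] split q m + r into m balanced parts, and each part is monotone in the
    total. Raising the total by d thus raises the positive parts by at most d altogether. *)
Lemma clip_sum_lipschitz (m : nat) (g : 'I_m -> int) (q r q' r' : int) :
  0 <= r <= m%:Z -> 0 <= r' <= m%:Z ->
  clip_sum m g q r <= clip_sum m g q' r' + Num.max 0 (q * m%:Z + r - (q' * m%:Z + r')).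
Proof.
move=> rm rm'.
have sumE (p s : int) : 0 <= s <= m%:Z ->
    p * m%:Z + s = \sum_(i < m) (p + (i%:Z < s)%R%:Z).
  move=> sm; rewrite big_split /= sum_lt // sumr_const card_ord -mulr_natl; lia.
have mono (p s p' s' : int) : 0 <= s <= m%:Z -> 0 <= s' <= m%:Z ->
    p * m%:Z + s <= p' * m%:Z + s' ->
    forall i : 'I_m, p + (i%:Z < s)%R%:Z <= p' + (i%:Z < s')%R%:Z.
  move=> sm sm' le i; have := ltn_ord i => im.
  have [lt|gt|eq] := ltgtP p p'; [by lia| |by subst p'; lia].
  have : 0 <= (p - p' - 1) * m%:Z by apply: mulr_ge0; lia.
  have [pE|ne] := eqVneq p (p' + 1); first by subst p; lia.
  have : 0 <= (p - p' - 2) * m%:Z by apply: mulr_ge0; lia.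
  by lia.
have [le|/ltW ge] := leP (q * m%:Z + r) (q' * m%:Z + r').
  have le_clip : clip_sum m g q r <= clip_sum m g q' r'.
    by apply: ler_sum => i _; have := mono _ _ _ _ rm rm' le i; lia.
  by lia.
apply: le_trans (_ : clip_sum m g q' r' + (q * m%:Z + r - (q' * m%:Z + r')) <= _);
  last by lia.
rewrite !sumE // -sumrB -big_split /=; apply: ler_sum => i _.
by have := mono _ _ _ _ rm' rm ge i; lia.
Qed.

(** * Level counts and the exchange argument *)

Lemma sum_indicator (L N : nat) (p q : int) : - L%:Z <= p -> q <= N%:Z ->
  \sum_(k < L + N) (p <= k%:Z - L%:Z < q)%R%:Z = Num.max 0 (q - p).
Proof.
move=> pL qN.
suff H M : \sum_(k < M) (p <= k%:Z - L%:Z < q)%R%:Z =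
    Num.max 0 (Num.min q (M%:Z - L%:Z) - p) by rewrite H; lia.
elim: M => [|M IH]; first by rewrite big_ord0; lia.
by rewrite big_ord_recr /= IH; lia.
Qed.

Definition nb_le (m : nat) (a : 'I_m -> int) (t : int) : int :=
  \sum_i (a i <= t)%R%:Z.

(* The shift by L lets k - L range over the integers t with - L <= t < m. *)
Definition overlap (m : nat) (L : nat) (g a : 'I_m -> int) : int :=
  \sum_(k < L + m) Num.max 0 (nb_le m a (k%:Z - L%:Z) - nb_le m g (k%:Z - L%:Z)).

Lemma nb_le_ge0 (m : nat) (a : 'I_m -> int) (t : int) : 0 <= nb_le m a t.
Proof. by apply: sumr_ge0. Qed.

(** For each t, at least [nb_le m a t - nb_le m g t] indices satisfy a i <= t < g i; summing over t
    counts each i exactly max(0, g i - a i) times. *)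
Lemma overlap_le (m L : nat) (g a : 'I_m -> int) :
  (forall i, - L%:Z <= a i) -> (forall i, g i < m%:Z) ->
  overlap m L g a <= \sum_i Num.max 0 (g i - a i).
Proof.
move=> aL gm.
rewrite [leRHS](eq_bigr (fun i => \sum_(k < L + m) (a i <= k%:Z - L%:Z < g i)%R%:Z)).
  rewrite exchange_big /=; apply: ler_sum => k _.
  rewrite ge_max sumr_ge0 //= -sumrB.
  by apply: ler_sum => i _; lia.
by move=> i _; rewrite sum_indicator //; exact: ltW.
Qed.

(** By monotonicity, a i <= t < g i and g j <= t < a j cannot both occur for the same t, so nothing
    cancels in the difference of counts. *)
Lemma overlap_sorted (m L : nat) (g a : 'I_m -> int) :
  (forall i, - L%:Z <= a i) -> (forall i, g i < m%:Z) ->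
  {homo g : i j / (i <= j)%N >-> i <= j} -> {homo a : i j / (i <= j)%N >-> i <= j} ->
  overlap m L g a = \sum_i Num.max 0 (g i - a i).
Proof.
move=> aL gm g_mono a_mono.
rewrite [RHS](eq_bigr (fun i => \sum_(k < L + m) (a i <= k%:Z - L%:Z < g i)%R%:Z)).
  rewrite exchange_big /=; apply: eq_bigr => k _; move: (k%:Z - L%:Z) => t.
  rewrite /nb_le -sumrB; have [/existsP[i it]|/existsPn none] :=
    boolP [exists i, a i <= t < g i].
    rewrite [in LHS](eq_bigr (fun i => (a i <= t < g i)%R%:Z)) => [|j _].
      by rewrite max_r //; apply: sumr_ge0.
    have [ij|/ltnW ji] := leqP i j; first by have := g_mono _ _ ij; lia.
    by have := a_mono _ _ ji; lia.
  rewrite [RHS]big1 => [|i _]; last by have := none i; lia.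
  apply: max_l; apply: sumr_le0 => i _; have := none i; lia.
by move=> i _; rewrite sum_indicator //; exact: ltW.
Qed.

(* Write x = a i, y = a j, n = m + 1.  For t < 0 only a counts, since g >= 0; for
   0 <= t < m the increment of the positive part is at most 1, and it occurs only
   on [y - n, y) \ [x, x + n).  That set is a translate by at least n of
   [x, x + n) \ [y - n, y), so its part below m comes from negative t. *)
Lemma overlap_exchange (m L : nat) (g a : 'I_m -> int) (i j : 'I_m) :
  (forall k, - L%:Z <= a k) -> (forall k, 0 <= g k) ->
  a i + m.+1%:Z < a j ->
  overlap m L g (fun k => a k + m.+1%:Z * ((k == i)%:Z - (k == j)%:Z)) <=
  overlap m L g a.
Proof.
move=> aL g_ge0 lt_ij; set a' := fun k => _.
have ij : i != j by apply: contraTneq lt_ij => ->; lia.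
set x := a i in lt_ij; set y := a j in lt_ij.
pose I t := (x <= t < x + m.+1%:Z)%R%:Z.
pose J t := (y - m.+1%:Z <= t < y)%R%:Z.
have nbE t : nb_le m a' t = nb_le m a t - I t + J t.
  rewrite /nb_le (bigD1 i) //= [X in _ = X - _ + _](bigD1 i) //=.
  rewrite (bigD1 j) ?(eq_sym j) //= [X in _ = _ + X - _ + _](bigD1 j) ?(eq_sym j) //=.
  rewrite (eq_bigr (fun k => (a k <= t)%R%:Z)) => [|k /andP[/negbTE ki /negbTE kj]].
    rewrite /a' !eqxx (negbTE ij) eq_sym (negbTE ij) /I /J -/x -/y.
    by move: (\sum_(_ | _) _) => s; lia.
  by rewrite /a' ki kj; lia.
(* The two set differences of the windows are [x, z) and [x + y - z, y). *)
pose z := Num.min (x + m.+1%:Z) (y - m.+1%:Z).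
suff : overlap m L g a' - overlap m L g a <=
  \sum_(k < L + m) (x + y - z <= k%:Z - L%:Z < Num.min y m%:Z)%R%:Z -
  \sum_(k < L + m) (x <= k%:Z - L%:Z < Num.min z 0)%R%:Z.
  have xL := aL i; rewrite -/x in xL.
  by rewrite !sum_indicator /z; lia.
rewrite -!sumrB; apply: ler_sum => k _.
have : k%:Z - L%:Z < m%:Z by have := ltn_ord k; lia.
move: (k%:Z - L%:Z) => t tm.
have := nb_le_ge0 m a t; have := nb_le_ge0 m a' t.
have g0 : t < 0 -> nb_le m g t = 0.
  by move=> t0; apply: big1 => l _; have := g_ge0 l; lia.
rewrite nbE /I /J /z; have [t0|t0] := ltP t 0.
  by rewrite (g0 t0); move: (nb_le m a t) => s; lia.
by move: (nb_le m a t) (nb_le m g t) => s s'; lia.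
Qed.

(** An injection into a set with one more point misses exactly one value j, and [lift j] enumerates
    the others. *)
Lemma injective_lift (m : nat) (b : 'I_m -> 'I_m.+1) : injective b ->
  exists j, forall F : 'I_m.+1 -> int, \sum_i F (b i) = \sum_i F (lift j i).
Proof.
move=> b_inj.
have /existsP[j jb] : [exists j, j \notin codom b].
  rewrite -negb_forall; apply/negP => /forallP all_b.
  have : (#|'I_m.+1| <= #|codom b|)%N by apply: subset_leq_card; apply/subsetP => k _.
  by rewrite card_codom // !card_ord ltnn.
exists j => F; have ne i : j != b i by apply: contraNneq jb => ->; exact: codom_f.
pose s i := odflt i (unlift j (b i)).
have sE i : lift j (s i) = b i.
  by rewrite /s; case: unliftP => [k ->|jE] //; have := ne i; rewrite {1}jE eqxx.
have s_inj : injective s by move=> i k /(congr1 (lift j)); rewrite !sE => /b_inj.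
rewrite [RHS](reindex_inj s_inj) /=; apply: eq_bigr => i _; by rewrite sE.
Qed.

(** [overlap] depends only on the set of values of [a], here m + 1 consecutive integers with one
    removed, so [a] may be replaced by its increasing enumeration. *)
Lemma overlap_window (m L : nat) (g a : 'I_m -> int) : (0 < m)%N ->
  (forall i, - L%:Z <= a i) -> (forall i, g i < m%:Z) ->
  {homo g : i j / (i <= j)%N >-> i <= j} -> injective a ->
  (forall i j, a j <= a i + m%:Z) ->
  exists q r, [/\ 0 <= r <= m%:Z, clip_sum m g q r = overlap m L g a &
    \sum_i a i = \sum_(i < m) i%:Z - (q * m%:Z + r)].
Proof.
move=> m_gt0 aL gm g_mono a_inj window.
have [i0 _ i0_min] := @Order.TotalTheory.arg_minP _ _ _ (Ordinal m_gt0) xpredT a isT.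
pose b i : 'I_m.+1 := inord `|a i - a i0|.
have bE i : a i = a i0 + (b i)%:Z.
  have := window i0 i; have := i0_min i isT => i0i wi.
  by rewrite /b inordK; lia.
have b_inj : injective b.
  by move=> i k bik; apply: a_inj; rewrite bE [in RHS]bE bik.
have [j jE] := injective_lift m b b_inj.
(* The sorted entry i is the minimum plus i + [j <= i], that is i - q - [i < r]. A gap at the top
   end gives r = m. *)
pose q := - a i0 - 1; pose r := j%:Z.
pose a1 (i : 'I_m) := i%:Z - q - (i%:Z < r)%R%:Z.
have a1E (i : 'I_m) : a1 i = a i0 + (lift j i)%:Z.
  by rewrite /a1 /q /r /= /bump; lia.
have rm : 0 <= r <= m%:Z by have := ltn_ord j; rewrite /r; lia.
have clipE : clip_sum m g q r = \sum_i Num.max 0 (g i - a1 i).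
  by apply: eq_bigr => i _; rewrite /a1; congr Num.max; lia.
exists q, r; split=> //.
  rewrite clipE -(overlap_sorted m L) //; last 2 first.
  - by move=> i; rewrite a1E; have := aL i0; lia.
  - by move=> i k ik; rewrite !a1E /= /bump; lia.
  apply: eq_bigr => k _; congr (Num.max 0 (_ - _)); rewrite /nb_le.
  rewrite [RHS](eq_bigr (fun i => (a i0 + (b i)%:Z <= k%:Z - L%:Z)%R%:Z)) => [|i _].
    rewrite (jE (fun l => (a i0 + l%:Z <= k%:Z - L%:Z)%R%:Z)).
    by apply: eq_bigr => i _; rewrite a1E.
  by rewrite -bE.
rewrite (eq_bigr (fun i => a i0 + (b i)%:Z)) => [|i _]; last exact: bE.
rewrite (jE (fun l => a i0 + l%:Z)) (eq_bigr a1) => [|i _]; last by rewrite a1E.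
clearbody q r; rewrite /a1 !sumrB sum_lt // sumr_const card_ord -mulr_natr natz.
by move: (\sum_(i < m) i%:Z) => S; lia.
Qed.

(** Each exchange strictly decreases the sum of squares, so the process ends with all entries in one
    window. *)
Lemma clip_sum_le_overlap (m L : nat) (g a : 'I_m -> int) : (0 < m)%N ->
  (forall i, - L%:Z <= a i) -> (forall i, 0 <= g i < m%:Z) ->
  {homo g : i j / (i <= j)%N >-> i <= j} -> distinct_residues m.+1 a ->
  exists q r, [/\ 0 <= r <= m%:Z, clip_sum m g q r <= overlap m L g a &
    \sum_i a i = \sum_(i < m) i%:Z - (q * m%:Z + r)].
Proof.
move=> m_gt0 aL gm g_mono a_inj.
have [k] : exists k : nat, (\sum_i a i ^+ 2 < k%:Z)%R.
  by exists `|(\sum_i a i ^+ 2)%R|%N.+1; lia.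
elim: k a aL a_inj => [|k IH] a aL a_inj ak.
  by move: ak; rewrite ltNge sumr_ge0 // => i _; exact: sqr_ge0.
have [/existsP[i /existsP[j lt_ij]]|none] :=
  boolP [exists i, exists j, a i + m.+1%:Z < a j]; last first.
  have window i j : a j <= a i + m%:Z.
    move/existsPn: none => /(_ i)/existsPn/(_ j); rewrite -leNgt => le.
    (* A difference of exactly m + 1 would contradict the distinct residues. *)
    have [eq|ne] := eqVneq (a j) (a i + m.+1%:Z); last by lia.
    have ij : i = j by apply: a_inj; rewrite /= eq modzDr.
    by rewrite ij; lia.
  have a_inj' : injective a by move=> i j ij; apply: a_inj; rewrite /= ij.
  have [|q [r [rm clipE sumE]]] := overlap_window m L g a m_gt0 aL _ g_mono a_inj' window.
    by move=> i; have /andP[] := gm i.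
  by exists q, r; rewrite clipE.
have ij : i != j by apply: contraTneq lt_ij => ->; lia.
pose a' l := a l + m.+1%:Z * ((l == i)%:Z - (l == j)%:Z).
have a'i : a' i = a i + m.+1%:Z by rewrite /a' eqxx (negbTE ij); lia.
have a'j : a' j = a j - m.+1%:Z by rewrite /a' eqxx eq_sym (negbTE ij); lia.
have a'E l : l != i -> l != j -> a' l = a l.
  by move=> /negbTE li /negbTE lj; rewrite /a' li lj; lia.
have rearrange (F : int -> int) : \sum_l F (a' l) =
    \sum_l F (a l) + F (a' i) - F (a i) + F (a' j) - F (a j).
  rewrite (bigD1 i) //= (bigD1 j) ?(eq_sym j) //=.
  rewrite [in RHS](bigD1 i) //= [in RHS](bigD1 j) ?(eq_sym j) //=.
  rewrite (eq_bigr (fun l => F (a l))) => [|l /andP[li lj]]; last by rewrite a'E.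
  by ring.
have [l|l l' /= ll'||q [r [rm le_clip sumE]]] := IH a'.
- have [->|li] := eqVneq l i; first by have := aL i; lia.
  have [->|lj] := eqVneq l j; first by have := aL i; lia.
  by rewrite a'E.
- apply: a_inj; move: ll'; rewrite /a'.
  by rewrite !(addrC (a _)) !(mulrC m.+1%:Z) !modzMDl.
- rewrite (rearrange (fun z => z ^+ 2)) a'i a'j.
  have : 0 <= m.+1%:Z * (a j - a i - m.+1%:Z - 1) by apply: mulr_ge0; lia.
  by move: (\sum_l _) ak => S; lia.
exists q, r; split=> //.
  apply: le_trans le_clip _; apply: overlap_exchange => // l.
  by have /andP[] := gm l.
by rewrite -sumE (rearrange id) a'i a'j; lia.
Qed.

(** The extra maximum becomes the cost at the last vertex, once q m + r is f_n + 1 and the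
    difference of sums is u_n + 1. *)
Lemma clip_sum_le (m : nat) (g a : 'I_m -> int) (q r : int) : (0 < m)%N ->
  (forall i, 0 <= g i < m%:Z) -> {homo g : i j / (i <= j)%N >-> i <= j} ->
  distinct_residues m.+1 a -> 0 <= r <= m%:Z ->
  clip_sum m g q r <= \sum_i Num.max 0 (g i - a i) +
    Num.max 0 (q * m%:Z + r - (\sum_(i < m) i%:Z - \sum_i a i)).
Proof.
move=> m_gt0 gm g_mono a_inj rm.
pose L := \max_i `|a i|%N.
have aL i : - L%:Z <= a i.
  have : (`|a i| <= L)%N by exact: leq_bigmax.
  by lia.
have [q' [r' [rm' le_clip ->]]] := clip_sum_le_overlap m L g a m_gt0 aL gm g_mono a_inj.
have le_sum : overlap m L g a <= \sum_i Num.max 0 (g i - a i).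
  by apply: overlap_le => // i; have /andP[] := gm i.
rewrite subKr; apply: le_trans (clip_sum_lipschitz m g q r q' r' rm rm') _.
by rewrite lerD2r (le_trans le_clip).
Qed.

(** * The rank as a minimal cost *)

(** A removal that destroys effectivity still does so when enlarged, so failure at degree T
    propagates to every larger degree. *)
Lemma rank_min (n : nat) (f : config n) (T : int) : (0 < n)%N ->
  (forall l : config n, effective l -> ~ L_effective (f - l) -> T <= deg l) ->
  (exists l : config n, [/\ effective l, deg l = T & ~ L_effective (f - l)]) ->
  1 + rank f = T.
Proof.
move=> n_gt0 lb [l [l_ge0 deg_l nL]].
have deg_ge0 (h : config n) : effective h -> 0 <= deg h.
  by move=> h_ge0; apply: sumr_ge0 => i _; exact: h_ge0.
have eff0 : effective (0 : config n) by move=> i; rewrite ffunE.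
have deg0 : deg (0 : config n) = 0 by rewrite /deg big1 // => i _; rewrite ffunE.
have T_ge0 : 0 <= T by rewrite -deg_l; exact: deg_ge0.
have [rankL rankN] := rankP f n_gt0; have [Lf|nLf] := boolp.pselect (L_effective f).
  suff -> : rank f = T - 1 by ring.
  apply: largest_uniq (rankL Lf) _; split=> [h h_ge0 deg_h|s all_s].
    by case: (boolp.pselect (L_effective (f - h))) => // /(lb h h_ge0); rewrite deg_h; lia.
  have [//|lt] := leP s (T - 1); case: nL.
  pose b : config n := basis_vector (Ordinal n_gt0) *+ `|s - T|%N.
  have b_ge0 : effective b by move=> i; rewrite ffunMnE mulrn_wge0 // ffunE ler0n.
  have deg_b : deg b = s - T.
    by rewrite /b [X in deg X]pmulrn degMz deg_basis_vector; lia.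
  clearbody b; apply: L_effective_le (all_s (l + b) _ _).
  - by move=> i; have := b_ge0 i; rewrite !ffunE; move: (f i) (l i) (b i); lia.
  - by move=> i; rewrite ffunE addr_ge0 ?l_ge0 ?b_ge0.
  - by have := degB (l + b) b; rewrite addrK deg_l deg_b; lia.
(* Removing 0 already fails here, which gives T <= 0. *)
rewrite (rankN nLf) subrr; apply/le_anti; rewrite T_ge0 /=.
by rewrite -deg0; apply: lb; rewrite ?subr0.
Qed.

(** A maximal [u] above [f - l] forces l >= max(0, f - u) entrywise, and [clip_sum_le] bounds the
    sum of these maxima. *)
Lemma rank_lower (m : nat) (f : config m.+1) (s : {perm 'I_m.+1}) (g : 'I_m -> int)
    (q r : int) (l : config m.+1) : (0 < m)%N ->
  (forall i, f (s (widen_ord (leqnSn m) i)) = g i) ->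
  (forall i, 0 <= g i < m%:Z) -> {homo g : i j / (i <= j)%N >-> i <= j} ->
  0 <= r <= m%:Z -> f (s ord_max) + 1 = q * m%:Z + r ->
  effective l -> ~ L_effective (f - l) -> clip_sum m g q r <= deg l.
Proof.
move=> m_gt0 gE gm g_mono rm fE l_ge0 nL.
have [u [le_u u_inj sum_u]] := not_L_effective_le_distinct m.+1 (f - l) isT nL.
pose a i := u (s (widen_ord (leqnSn m) i)).
have a_inj : distinct_residues m.+1 a.
  by move=> i j /u_inj /perm_inj /(congr1 val) /= /val_inj.
have sum_a : \sum_(i < m) i%:Z - \sum_i a i = u (s ord_max) + 1.
  move: sum_u; rewrite (reindex_inj (@perm_inj _ s)) !big_ord_recr /= -/(a _).
  by move: (\sum_(i < m) _) (\sum_(i < m) _) (u _) => x y z; lia.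
apply: le_trans (clip_sum_le m g a q r m_gt0 gm g_mono a_inj rm) _.
rewrite sum_a -fE /deg (reindex_inj (@perm_inj _ s)) big_ord_recr /=.
have le k : Num.max 0 (f k - u k) <= l k.
  by have := le_u k; have := l_ge0 k; rewrite !ffunE; move: (f k) (u k) (l k); lia.
apply: lerD; first by apply: ler_sum => i _; rewrite -gE; exact: le.
by have := le (s ord_max); rewrite opprD addrACA subrr addr0.
Qed.

Lemma rank_upper (m : nat) (f : config m.+1) (s : {perm 'I_m.+1}) (g : 'I_m -> int)
    (q r : int) :
  (forall i, f (s (widen_ord (leqnSn m) i)) = g i) ->
  0 <= r <= m%:Z -> f (s ord_max) + 1 = q * m%:Z + r ->
  exists l : config m.+1, [/\ effective l, deg l = clip_sum m g q r & ~ L_effective (f - l)].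
Proof.
move=> gE rm fE.
(* The optimal [u] in sorted order; its last entry agrees with [f], so it costs nothing. *)
pose v (k : 'I_m.+1) : int :=
  if (k < m)%N then k%:Z - q - (k%:Z < r)%R%:Z else q * m%:Z + r - 1.
pose u : config m.+1 := [ffun k => v (s^-1%g k)].
have v_inj : distinct_residues m.+1 v.
  (* Modulo m + 1 the last entry is r - q - 1, the one value that the others leave free between -q -
     1 and m - 1 - q. *)
  pose w (k : 'I_m.+1) : int :=
    if (k < m)%N then k%:Z - q - (k%:Z < r)%R%:Z else r - q - 1.
  have w_bd k : - q - 1 <= w k <= m%:Z - 1 - q.
    by have k_lt := ltn_ord k; rewrite /w; case: ltnP; lia.
  have vw k : (v k = w k %[mod m.+1])%Z.
    rewrite /v /w; case: ltnP => // _.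
    have -> : q * m%:Z + r - 1 = q * m.+1%:Z + (r - q - 1) by lia.
    by rewrite modzMDl.
  have w_eq j k : w j = w k -> j = k.
    move=> jk; apply: val_inj => /=; have j_lt := ltn_ord j; have k_lt := ltn_ord k; move: jk.
    by rewrite /w; case: (ltnP j m); case: (ltnP k m); lia.
  move=> j k; rewrite /= !vw => /eqP; rewrite eqz_mod_dvd => /dvdzP[c cE].
  apply: w_eq; have := w_bd j; have := w_bd k.
  have [lt|gt|c0] := ltgtP c 0; last by move: cE; rewrite c0 mul0r; lia.
    have : 0 <= (- c - 1) * m.+1%:Z by apply: mulr_ge0; lia.
    by lia.
  have : 0 <= (c - 1) * m.+1%:Z by apply: mulr_ge0; lia.
  by lia.
have u_inj : distinct_residues m.+1 u.
  by move=> j k; rewrite /= !ffunE => /v_inj /perm_inj.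
have us k : u (s k) = v k by rewrite ffunE permK.
have sum_u : \sum_k u k = \sum_(k < m.+1) k%:Z - m.+1%:Z.
  rewrite (reindex_inj (@perm_inj _ s)) (eq_bigr v) => [|k _]; last exact: us.
  rewrite !big_ord_recr /= {2}/v /= ltnn.
  rewrite (eq_bigr (fun i : 'I_m => i%:Z - (q + (i%:Z < r)%R%:Z))) => [|i _]; last first.
    by rewrite /v /= ltn_ord; lia.
  rewrite sumrB big_split /= sum_lt // sumr_const card_ord -mulr_natr natz.
  by move: (\sum_(i < m) _) => x; lia.
pose l : config m.+1 := [ffun k => Num.max 0 (f k - u k)].
exists l; split.
- by move=> k; rewrite ffunE le_max lexx.
- rewrite /deg (reindex_inj (@perm_inj _ s)) big_ord_recr /=.
  rewrite [X in _ + X]ffunE us /v ltnn -fE addrK subrr maxxx addr0.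
  apply: eq_bigr => i _; rewrite ffunE us /v /= ltn_ord gE.
  by congr Num.max; lia.
- move/(L_effective_le _ _ u) => Lu; apply: (not_L_effective_distinct _ u) => //.
  apply: Lu => k; rewrite !ffunE.
  by move: (f k) (v _) => x y; lia.
Qed.

(** * Sorting, heights and the final formula *)

Lemma rearrangement_perm (m : nat) (f : config m.+1) :
  exists s : {perm 'I_m.+1}, s ord_max = ord_max /\
    forall i : 'I_m, f (s (widen_ord (leqnSn m) i)) = (rearrangement f)`_i.
Proof.
pose t := [tuple f (widen_ord (leqnSn m) i) | i < m].
have /tuple_permP[p pE] : perm_eq (rearrangement f) t.
  rewrite /rearrangement perm_sort enum_ordSr filter_rcons /= ltnn.
  rewrite filter_map (eq_filter (a2 := xpredT)) => [|i]; last by rewrite /= ltn_ord.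
  by rewrite filter_predT -map_comp.
exists (lift_perm ord_max ord_max p); split=> [|i]; first by rewrite lift_perm_id.
have widenE (k : 'I_m) : widen_ord (leqnSn m) k = lift ord_max k.
  by apply: val_inj; rewrite /= /bump leqNgt ltn_ord.
by rewrite widenE lift_perm_lift pE -tnth_nth !tnth_mktuple widenE.
Qed.

(** The two prefixes around the occurrence differ by one letter a, so they contain equally many
    b. *)
Lemma height_phi (n : nat) (f : config n) (i : nat) : parking f -> (i < n.-1)%N ->
  height (phi f) i.+1 = i%:Z - (rearrangement f)`_i.
Proof.
move=> f_parking lt_i; have [[aw _ _] phiE] := phiP f_parking.
have := phiE i.+1 lt_i; rewrite /= => <-.
have [|lt_p a_before a_upto] := @pos_aP (phi f) i; first by rewrite aw.
have := nb_ab (prefix_before (phi f) i.+1); have := nb_ab (prefix_upto (phi f) i.+1).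
rewrite a_before a_upto /height /delta a_before !size_takel //; last exact: ltnW.
by lia.
Qed.

Theorem theorem5 (n : nat) (n_ge2 : (2 <= n)%N) (f : config n) (f_parking : parking f)
    (w : word) (w_phi : w = phi f) (q r : int)
    (qr_div : f (last_vertex n_ge2) + 1 = q * (n%:Z - 1) + r)
    (r_rem : 0 <= r < n%:Z - 1) :
  1 + rank f =
    \sum_(1 <= i < n) Num.max 0 (q - height w i + (if i%:Z <= r then 1 else 0)).
Proof.
case: n n_ge2 f f_parking w_phi qr_div r_rem => // m n_ge2 f f_parking w_phi qr_div r_rem.
have mE : m.+1%:Z - 1 = m%:Z by lia.
rewrite mE in qr_div r_rem.
have [s [s_max sE]] := rearrangement_perm m f.
have rm : 0 <= r <= m%:Z by lia.
have fE : f (s ord_max) + 1 = q * m%:Z + r.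
  by rewrite s_max -qr_div; congr (f _ + 1); exact: val_inj.
transitivity (clip_sum m (fun i => (rearrangement f)`_i) q r); last first.
  rewrite big_add1 big_mkord; apply: eq_bigr => i _; congr Num.max.
  (* Numbering from 0 instead of 1 turns the condition i <= r into a strict one. *)
  rewrite w_phi height_phi // (_ : (i%:Z < r) = (i.+1%:Z <= r)); last by lia.
  by case: ifP => _ /=; lia.
apply: rank_min => //; last exact: rank_upper sE rm fE.
move=> l; apply: rank_lower sE _ _ rm fE => // [i|i j ij].
  rewrite rearrangement_ge0 //=.
  by apply: le_lt_trans (rearrangement_le f_parking _) _; rewrite /= ?ltz_nat.
exact: rearrangement_mono.
Qed.
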